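(* (1) There exists a tame$_{\mathbf 1}$ almost automorphic $\mathbb Z$-system which is not tame$_{\mathbf 2}$. (2) There are two disjoint minimal tame$_{\mathbf 2}$ systems whose product (which is minimal and tame$_{\mathbf 1}$) is not tame$_{\mathbf 2}$.
   Context: A dynamical system $(X,T)$ is a compact Hausdorff space $X$ with a continuous homomorphism $j\colon T\to \mathrm{Homeo}(X)$ from a topological group $T$; a $\mathbb Z$-system is given by a single homeomorphism. The enveloping semigroup $E(X,T)$ is the closure of $j(T)$ in $X^X$ with the pointwise topology. A compact metrizable system is tame$_{\mathbf 1}$ if $E(X,T)$ is first countable, and tame$_{\mathbf 2}$ if $E(X,T)$ is hereditarily separable (every subspace is separable). A factor map $\pi\colon X\to Y$ of minimal metrizable systems (continuous equivariant surjection) is an almost one-to-one extension if $X_0=\{x\in X:\pi^{-1}(\pi(x))=\{x\}\}$ is a dense $G_\delta$ in $X$. A minimal system is almost automorphic if it admits an almost one-to-one extension onto an equicontinuous system. Two minimal systems $(X,T)$, $(Y,T)$ are disjoint if the product system $X\times Y$ with the diagonal $T$-action is minimal. *)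

(* Defs.v *)
From HB Require Import structures.
From mathcomp Require Import all_boot all_order all_algebra.
From mathcomp Require Import all_classical all_reals all_analysis.
From mathcomp Require Import borel_hierarchy.

Set Implicit Arguments.
Unset Strict Implicit.
Unset Printing Implicit Defensive.

Local Open Scope classical_set_scope.

HB.mixin Record isTopologicalGroup G & Topological G & Group G := {
  mulg_continuous : continuous (fun p : G * G => (p.1 * p.2)%g) ;
  invg_continuous : continuous (fun x : G => (x^-1)%g)
}.

#[short(type="topologicalGroupType")]
HB.structure Definition TopologicalGroup :=
  { G of Topological G & Group G & isTopologicalGroup G }.

(* The integers as a discrete group, written multiplicatively: on Zgroup,
   x * y is the sum of the integers x and y, and 1 is the integer 0. *)
Definition Zgroup : Type := Algebra.to_multiplicative int.

HB.instance Definition _ := Group.on Zgroup.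
HB.instance Definition _ := hasNbhs.Build Zgroup principal_filter.
HB.instance Definition _ := Discrete_ofNbhs.Build Zgroup erefl.

Lemma Zgroup_mulg_continuous :
  continuous (fun p : Zgroup * Zgroup => (p.1 * p.2)%g).
Proof.
move=> [x y] A /= /principal_filterP Axy.
exists ([set x], [set y]) => /=; first by split; apply/principal_filterP.
by move=> [a b] /= [-> ->].
Qed.

Lemma Zgroup_invg_continuous : continuous (fun x : Zgroup => (x^-1)%g).
Proof. by move=> x A /principal_filterP Ax; apply/principal_filterP. Qed.

HB.instance Definition _ := isTopologicalGroup.Build Zgroup
  Zgroup_mulg_continuous Zgroup_invg_continuous.

Definition metrizable (R : realType) (X : topologicalType) :=
  exists (M : metricType R) (f : X -> M) (g : M -> X),
    [/\ cancel f g, cancel g f, continuous f & continuous g].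

Definition first_countable (X : topologicalType) :=
  forall x : X, exists B : set (set X),
    [/\ countable B, forall U, B U -> nbhs x U &
        forall V, nbhs x V -> exists2 U, B U & U `<=` V].

Definition separable_space (X : topologicalType) :=
  exists2 D : set X, countable D & dense D.

(* set_type A is the subset A as a type, with the subspace topology. *)
Definition hereditarily_separable (X : topologicalType) :=
  forall A : set X, separable_space (set_type A).

(* Since j is multiplicative, every j t is a homeomorphism of X, with inverse
   j t^-1; Homeo(X) carries the compact-open topology, which for compact X is
   the topology of uniform convergence. *)
Definition dynamical_system (T : topologicalGroupType) (X : topologicalType)
    (j : T -> X -> X) :=
  [/\ compact [set: X] /\ hausdorff_space X,
      j 1%g = id /\ (forall s t, j (s * t)%g = j s \o j t),
      forall t, continuous (j t) &
      continuous (j : T -> {compact-open, X -> X})].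

Definition enveloping_semigroup (T : Type) (X : topologicalType)
    (j : T -> X -> X) : set {ptws X -> X} :=
  closure (range (j : T -> {ptws X -> X})).

Definition tame1 (R : realType) (T : topologicalGroupType)
    (X : topologicalType) (j : T -> X -> X) :=
  [/\ dynamical_system j, metrizable R X &
      first_countable (set_type (enveloping_semigroup j))].

Definition tame2 (R : realType) (T : topologicalGroupType)
    (X : topologicalType) (j : T -> X -> X) :=
  [/\ dynamical_system j, metrizable R X &
      hereditarily_separable (set_type (enveloping_semigroup j))].

Definition minimal_system (T : topologicalGroupType) (X : topologicalType)
    (j : T -> X -> X) :=
  [/\ dynamical_system j, [set: X] !=set0 &
      forall A : set X, closed A -> A !=set0 ->
        (forall t, j t @` A `<=` A) -> A = [set: X]].

Definition factor_map (T : topologicalGroupType) (X Y : topologicalType)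
    (j : T -> X -> X) (k : T -> Y -> Y) (p : X -> Y) :=
  [/\ continuous p, range p = [set: Y] & forall t x, p (j t x) = k t (p x)].

Definition almost_one_to_one_extension (R : realType)
    (T : topologicalGroupType) (X Y : topologicalType)
    (j : T -> X -> X) (k : T -> Y -> Y) (p : X -> Y) :=
  let X0 := [set x | p @^-1` [set p x] = [set x]] in
  [/\ minimal_system j /\ minimal_system k,
      metrizable R X /\ metrizable R Y,
      factor_map j k p &
      dense X0 /\ Gdelta X0].

(* Equicontinuity refers to the unique uniformity of a compact Hausdorff space,
   so asking the base to be given as a uniformType is no restriction; it is
   moreover pointed since minimal systems are nonempty. *)
Definition almost_automorphic (R : realType) (T : topologicalGroupType)
    (X : topologicalType) (j : T -> X -> X) :=
  minimal_system j /\
  exists (Y : puniformType) (k : T -> Y -> Y) (p : X -> Y),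
    almost_one_to_one_extension R j k p /\ equicontinuous [set: T] k.

Definition product_action (T : Type) (X Y : Type)
    (j : T -> X -> X) (k : T -> Y -> Y) (t : T) (z : X * Y) : X * Y :=
  (j t z.1, k t z.2).

Definition disjoint_systems (T : topologicalGroupType)
    (X Y : topologicalType) (j : T -> X -> X) (k : T -> Y -> Y) :=
  [/\ minimal_system j, minimal_system k &
      minimal_system (product_action j k)].

(* Main.v *)
From HB Require Import structures.
From mathcomp Require Import zify.
Require Import Defs.
From mathcomp Require Import all_boot all_order all_algebra.
From mathcomp Require Import all_classical all_reals all_analysis.
From mathcomp Require Import borel_hierarchy.

Set Implicit Arguments.
Unset Strict Implicit.
Unset Printing Implicit Defensive.

Import Order.TTheory GRing.Theory Num.Theory.
Local Open Scope classical_set_scope.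
Local Open Scope ring_scope.

(** Both parts come from almost one-to-one extensions of the 5-adic odometer.
Color a non-zero 5-adic integer by whether its leading digit lies in a set [S],
and let [X] be the space of pairs of a 5-adic integer [z] and the sequence of
the colors of [z + n], [n] an integer, the color at [z + n = 0] being free.  The
shift [(z, s) |-> (z + 1, s (. + 1))] is minimal and the projection to the
odometer is one-to-one outside the countable set of integers.

An element [p] of the enveloping semigroup E of [X] induces a translation by a
5-adic integer, its angle, and commutes with the shift.  Since 0 is the only
discontinuity of the coloring, [p] is determined by its angle and by what it does
to the at most two points that it sends over 0, and it has a countable basis of
neighborhoods in E which say that angles are close and that the values at 0 are
the same ([window_base]).  Hence E is first countable.  Conversely E contains,
for each angle [k] and color [c], the limit of the integers tending to [k]
through differences of color [c] ([translate_closure]); the angles [k'] of the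
elements of E that are near this limit satisfy [k' - k = 0] or have
[k' - k] of color [c] ([bit_ellis]).  Everything about separability is read off
from the color of differences.

If [S] is [{1, 2}], opposite numbers have opposite colors, so E behaves like the
Sorgenfrey line (or the split circle, for Sturmian systems) and is hereditarily
separable ([zshifts_hereditarily_separable]).  Let the group of pairs of integers
act on two copies of [X], each coordinate moving one copy.  The product is
minimal and first countability persists, but the pairs of limits with angles
[a] and [- a] form an uncountable discrete set, as the antidiagonal does in the
Sorgenfrey plane ([product_not_tame2]).  This is the second example.

If [S] is [{2, 3}], opposite numbers have the same color, and E itself contains
an uncountable discrete set: the limits of color [true] with angles the sums of
distinct powers of 5, whose differences have leading digit 1 or 4 and so are
of color [false] ([zshifts_not_hereditarily_separable]).  This is the first
example. *)

(** * Metric spaces from nested equivalence relations *)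

(** All spaces below are profinite: points are compared up to a finite level,
and the level-[n] relations form a basis of the uniformity.  Working with the
relations keeps real numbers out of every later continuity argument. *)
Record levels := Levels {
  carrier :> Type;
  basepoint : carrier;
  lev : nat -> carrier -> carrier -> Prop;
  lev_refl : forall n x, lev n x x;
  lev_sym : forall n x y, lev n x y -> lev n y x;
  lev_trans : forall n y x z, lev n x y -> lev n y z -> lev n x z;
  lev_le : forall m n x y, (m <= n)%N -> lev n x y -> lev m x y;
  lev_sep : forall x y, (forall n, lev n x y) -> x = y
}.

Definition lspace (R : realType) (L : levels) : Type := L.

Section LevelMetric.
Variables (R : realType) (L : levels).
Implicit Types x y z : L.

(** For distinct points, the first level that tells them apart. *)
Definition gap x y : nat :=
  if pselect (exists n, ~~ `[< lev n x y >]) is left h then ex_minn h else 0.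

Definition ldist x y : R :=
  if `[< x = y >] then 0 else (gap x y).+1%:R^-1.

Lemma lev_gap x y n : x <> y -> lev n x y <-> (n < gap x y)%N.
Proof.
move=> xy; rewrite /gap; case: pselect => [h|nh]; last first.
  exfalso; apply/xy/lev_sep => k; apply/asboolP; apply: contrapT => /negP k0.
  by apply: nh; exists k.
case: ex_minnP => m /asboolPn Nm mmin; split.
  move=> nxy; rewrite ltnNge; apply/negP => mn; apply: Nm.
  exact: lev_le nxy.
move=> nm; apply: contrapT => Nn.
have /mmin : ~~ `[< lev n x y >] by apply/asboolPn.
by rewrite leqNgt nm.
Qed.

(** The only property of the distance used from here on: its balls are the
classes of the level relations. *)
Lemma ldist_lt x y n : ldist x y < n.+1%:R^-1 <-> lev n x y.
Proof.
rewrite /ldist; case: asboolP => [->|xy].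
  by split => _; [exact: lev_refl|rewrite invr_gt0].
by rewrite (lev_gap n xy) ltf_pV2 ?posrE// ltr_nat ltnS.
Qed.

Lemma ldist_ge0 x y : 0 <= ldist x y.
Proof. by rewrite /ldist; case: asboolP. Qed.

Lemma ldistxx x : ldist x x = 0.
Proof. by rewrite /ldist; case: asboolP. Qed.

Lemma ldist_eq0 x y : ldist x y = 0 -> x = y.
Proof.
by move=> xy; apply: lev_sep => n; apply/ldist_lt; rewrite xy invr_gt0.
Qed.

Lemma ldist_sym x y : ldist x y = ldist y x.
Proof.
rewrite /ldist; case: asboolP => [->|xy]; first by case: asboolP.
case: asboolP => [/esym//|yx]; congr (_.+1%:R^-1).
apply/eqP; rewrite eqn_leq; apply/andP; split; rewrite leqNgt; apply/negP.
  move=> /(lev_gap _ xy)/lev_sym/(lev_gap _ yx); by rewrite ltnn.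
move=> /(lev_gap _ yx)/lev_sym/(lev_gap _ xy); by rewrite ltnn.
Qed.

Lemma ldist_triangle y x z : ldist x z <= ldist x y + ldist y z.
Proof.
have [->|xz] := pselect (x = z).
  by rewrite ldistxx addr_ge0// ldist_ge0.
have Nl : ~ lev (gap x z) x z by move=> /lev_gap => /(_ xz); rewrite ltnn.
rewrite {1}/ldist asboolF//.
have [xy|xy] := ltP (ldist x y) (gap x z).+1%:R^-1; last first.
  by rewrite (le_trans xy)// lerDl ldist_ge0.
have [yz|yz] := ltP (ldist y z) (gap x z).+1%:R^-1; last first.
  by rewrite (le_trans yz)// lerDr ldist_ge0.
by exfalso; apply: Nl; apply: (lev_trans (y := y)); apply/ldist_lt.
Qed.
End LevelMetric.

HB.instance Definition _ (R : realType) (L : levels) := gen_eqMixin (lspace R L).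
HB.instance Definition _ (R : realType) (L : levels) := gen_choiceMixin (lspace R L).
HB.instance Definition _ (R : realType) (L : levels) :=
  isPointed.Build (lspace R L) (basepoint L).
HB.instance Definition _ (R : realType) (L : levels) :=
  @isMetric.Build R (lspace R L) (@ldist R L)
  (@ldistxx R L) (@ldist_eq0 R L) (@ldist_sym R L) (@ldist_triangle R L).

Section LevelTopology.
Variables (R : realType) (L : levels).
Implicit Types x y z : lspace R L.

Lemma entourage_lev (E : set (lspace R L * lspace R L)) :
  entourage E <-> exists n, forall x y, lev n x y -> E (x, y).
Proof.
rewrite -entourage_ballE; split=> [[e /= e0 eE]|[n nE]].
  have [n ne] : exists n, n.+1%:R^-1 < e.
    exists (Num.bound e^-1); rewrite -[e in _ < e]invrK ltf_pV2 ?posrE ?invr_gt0//.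
    by rewrite (lt_le_trans (archi_boundP _)) ?invr_ge0 ?(ltW e0)// ler_nat.
  exists n => x y nxy; apply: eE => /=; rewrite ballEmdist/=.
  by apply: lt_trans ne; apply/ldist_lt.
exists n.+1%:R^-1 => /=; first by rewrite invr_gt0.
by move=> [x y] /=; rewrite ballEmdist/= => /ldist_lt /nE.
Qed.

Lemma nbhs_lev x (U : set (lspace R L)) :
  nbhs x U <-> exists n, forall y, lev n x y -> U y.
Proof.
rewrite -nbhs_entourageE; split.
  move=> [E /entourage_lev[n nE] EU]; exists n => y xy; apply: EU.
  by apply/xsectionP; exact: nE.
move=> [n nU]; exists [set xy | lev n xy.1 xy.2].
  by apply/entourage_lev; exists n.
by move=> y /xsectionP; exact: nU.
Qed.

Lemma lspace_hausdorff : hausdorff_space (lspace R L).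
Proof. exact: metric_hausdorff. Qed.

Lemma lspace_metrizable : metrizable R (lspace R L).
Proof.
by exists (lspace R L), id, id; split=> // x; exact: cvg_id.
Qed.

(** Total boundedness and completeness, phrased with levels: an ultrafilter
picks one of the finitely many classes at each level, and a point lying in all
the chosen classes is its limit. *)
Lemma lspace_compact :
  (forall n, exists (k : finType) (g : L -> k),
     forall x y, g x = g y -> lev n x y) ->
  (forall u : nat -> L, (forall n, lev n (u n) (u n.+1)) ->
     exists x, forall n, lev n (u n) x) ->
  compact [set: lspace R L].
Proof.
move=> fin cpl; rewrite compact_ultra => F FU _.
have /choice[u uF] : forall n, exists y, F [set z : lspace R L | lev n y z].
  move=> n; have [k [g gn]] := fin n.
  apply: contrapT => /forallNP nF.
  have nFi (i : k) : F [set z : lspace R L | g z <> i].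
    have [Fi|//] := in_ultra_setVsetC [set z : lspace R L | g z = i] FU.
    have [z zi] := filter_ex Fi.
    exfalso; apply: (nF z); apply: filterS Fi => y yi.
    by apply: gn; rewrite zi yi.
  have nFall : F [set z : lspace R L | forall i, g z <> i] by exact: filter_forall.
  have [z nz] := filter_ex nFall.
  exact: nz (g z) erefl.
have [|x ux] := cpl u.
  move=> n; have /filter_ex[z [z1 z2]] :
      F ([set z | lev n (u n) z] `&` [set z | lev n.+1 (u n.+1) z]).
    exact: filterI.
  apply: (lev_trans z1); apply: lev_sym; exact: lev_le z2.
exists x; split=> // U /nbhs_lev[n nU]; apply: filterS (uF n) => z uz.
by apply: nU; apply: lev_trans uz; apply: lev_sym; exact: ux.
Qed.

End LevelTopology.

(** * Countability properties of subspaces *)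

Definition to_set_type (T : Type) (A : set T) x (Ax : A x) : set_type A :=
  exist (fun y => y \in A) x (mem_set Ax).

Lemma nbhs_set_type (Z : topologicalType) (E : set Z) (w : set_type E)
    (V : set (set_type E)) :
  nbhs w V <-> exists2 U, nbhs (set_val w) U & set_val @^-1` U `<=` V.
Proof.
split=> [[_ [[U oU <-] /= Uw UV]]|[U]].
  by exists U => //; exact: open_nbhs_nbhs.
rewrite nbhsE => -[G [oG Gw] GU] UV; rewrite nbhsE; exists (set_val @^-1` G).
  by split=> //; exists G.
by move=> z /GU /UV.
Qed.

(** Cantor's diagonal argument. *)
Lemma no_injection_to_nat (f : (nat -> bool) -> nat) : ~ injective f.
Proof.
move=> finj; pose d n := ~~ `[< exists2 u, f u = n & u n >].
have dE : d (f d) = ~~ d (f d).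
  rewrite {1}/d; congr (~~ _); apply/asboolP/idP => [[u /finj ->]//|dd].
  by exists d.
by case: (d (f d)) dE.
Qed.

Section Subspaces.
Variables (Z : topologicalType) (E : set Z).

(** A discrete subspace has no proper dense subset, so an uncountable one is
not separable.  It is enough to index the discrete set by bit sequences. *)
Lemma not_hereditarily_separable (P : (nat -> bool) -> Z) :
  (forall u, E (P u)) ->
  (forall u, exists2 U, nbhs (P u) U & forall v, U (P v) -> v = u) ->
  ~ hereditarily_separable (set_type E).
Proof.
move=> PE isol; pose A := [set w : set_type E | exists u, set_val w = P u].
move=> /(_ A) [D /countable_injP[f finj] Ddense].
have PA u : A (to_set_type (PE u)) by exists u.
pose pt u : set_type A := to_set_type (PA u).
have Dpt u : D (pt u).
  have [U nU Uu] := isol u.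
  have : nbhs (pt u) (fun w : set_type A => U (set_val (set_val w))).
    apply/nbhs_set_type; exists (set_val @^-1` U); last by [].
    by apply/nbhs_set_type; exists U.
  rewrite nbhsE => -[G [oG Gu] GU].
  have [||w [Gw Dw]] := Ddense G; [by exists (pt u)|by []|].
  have [v wv] : A (set_val w) by apply: set_valP.
  suff <- : w = pt u by [].
  apply: val_inj => /=; apply: val_inj => /=; rewrite -[LHS]/(set_val (set_val w)) wv.
  by congr P; apply: Uu; rewrite -wv; exact: GU.
apply: (@no_injection_to_nat (f \o pt)) => u v /finj puv.
have {}puv : P u = P v.
  by apply: (congr1 (set_val \o set_val) (_ : pt u = pt v)); apply: puv; exact: mem_set.
have [U nU Uu] := isol v; apply: Uu; rewrite puv.
exact: nbhs_singleton nU.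
Qed.

Variable B : nat -> Z -> set Z.
Hypothesis B_nbhs : forall p, E p -> forall n, nbhs p (B n p).
Hypothesis B_base : forall p U, E p -> nbhs p U ->
  exists n, forall q, E q -> B n p q -> U q.

Lemma first_countable_subspace : first_countable (set_type E).
Proof.
move=> w; exists [set set_val @^-1` B n (set_val w) | n in [set: nat]]; split.
- by apply: sub_countable (card_image_le _ _) _; exact: countableP.
- move=> _ [n _ <-]; apply/nbhs_set_type; exists (B n (set_val w)) => //.
  by apply: B_nbhs; exact: set_valP.
- move=> V /nbhs_set_type[U nU UV].
  have [|n nB] := B_base _ nU; first exact: set_valP.
  exists (set_val @^-1` B n (set_val w)); first by exists n.
  by move=> z zB; apply/UV/nB => //; exact: set_valP.
Qed.

Lemma hereditarily_separable_subspace :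
  (forall A : set Z, A `<=` E -> exists D : set Z, [/\ countable D, D `<=` A &
     forall p, A p -> forall n, exists2 q, D q & B n p q]) ->
  hereditarily_separable (set_type E).
Proof.
move=> sep A; pose val2 (w : set_type A) : Z := set_val (set_val w).
have val2_inj : injective val2 by move=> w z /val_inj/val_inj.
have [_ [w _ <-]|D [Dc DA Dd]] := sep [set set_val w | w in A].
  exact: set_valP.
exists (val2 @^-1` D).
  move/countable_injP: Dc => [f finj]; apply/countable_injP; exists (f \o val2).
  move=> w1 w2 /set_mem D1 /set_mem D2 /finj f12; apply: val2_inj.
  by apply: f12; exact: mem_set.
move=> G [w Gw] oG.
have : nbhs w G by apply: open_nbhs_nbhs.
move=> /nbhs_set_type[V /nbhs_set_type[U nU UV] VG].
have [|n nB] := B_base _ nU; first exact: set_valP.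
have [|q Dq Bq] := Dd (val2 w) _ n.
  by exists (set_val w) => //; exact: set_valP.
have [z Az zq] := DA q Dq.
pose v := to_set_type Az.
exists v; split; last by rewrite /= /val2 /= zq.
apply: VG; apply: UV; apply: nB; last by rewrite /= zq.
exact: set_valP.
Qed.
End Subspaces.

(** * The 5-adic integers *)

Definition pow5 (n : nat) : int := 5 ^+ n.

Lemma pow5_gt0 n : 0 < pow5 n. Proof. exact: exprn_gt0. Qed.

Lemma pow5_neq0 n : pow5 n != 0. Proof. by rewrite gt_eqF// pow5_gt0. Qed.

Lemma pow5S n : pow5 n.+1 = 5 * pow5 n. Proof. exact: exprS. Qed.

Lemma dvdz_pow5 m n : (m <= n)%N -> (pow5 m %| pow5 n)%Z.
Proof. by move=> mn; rewrite /pow5 -(subnK mn) exprD dvdz_mull. Qed.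

Lemma modz_pow5 m n a : (m <= n)%N -> ((a %% pow5 n)%Z %% pow5 m)%Z = (a %% pow5 m)%Z.
Proof.
move=> mn; rewrite [in RHS](divz_eq a (pow5 n)).
have /dvdzP[q ->] := dvdz_pow5 mn.
by rewrite mulrA modzMDl.
Qed.

(** A 5-adic integer is its sequence of residues modulo the powers of 5, each
represented in [0, 5^m); the case [m = n] of the condition enforces this
normal form, so that equality is equality of residues. *)
Record zadic := Zadic {
  residue :> nat -> int;
  residueP : forall m n, (m <= n)%N -> residue m = (residue n %% pow5 m)%Z }.

Lemma zadicP (x y : zadic) : (forall n, x n = y n) -> x = y.
Proof.
case: x y => [x xP] [y yP] /= /funext xy; case: _ / xy in yP *.
by congr Zadic; exact: Prop_irrelevance.
Qed.

Lemma residue_mod (x : zadic) n : (x n %% pow5 n)%Z = x n.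
Proof. by rewrite -residueP. Qed.

Section Compatible.
Variables (u : nat -> int)
  (uP : forall m n, (m <= n)%N -> (u m %% pow5 m)%Z = (u n %% pow5 m)%Z).

Lemma compatible_subproof m n : (m <= n)%N ->
  (u m %% pow5 m)%Z = ((u n %% pow5 n)%Z %% pow5 m)%Z.
Proof. by move=> mn; rewrite modz_pow5//; exact: uP. Qed.

Definition of_compatible := Zadic compatible_subproof.
End Compatible.

Definition of_int (t : int) : zadic :=
  of_compatible (u := fun=> t) (fun _ _ _ => erefl).

Lemma zadic_add_subproof (x y : zadic) m n : (m <= n)%N ->
  ((x m + y m) %% pow5 m)%Z = ((x n + y n) %% pow5 m)%Z.
Proof. by move=> mn; rewrite !(residueP _ mn) modzDm. Qed.

Lemma zadic_opp_subproof (x : zadic) m n : (m <= n)%N ->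
  ((- x m) %% pow5 m)%Z = ((- x n) %% pow5 m)%Z.
Proof. by move=> mn; rewrite !(residueP _ mn) modzNm. Qed.

Definition zadic_add x y := of_compatible (@zadic_add_subproof x y).
Definition zadic_opp x := of_compatible (@zadic_opp_subproof x).

Lemma zadic_addA : associative zadic_add.
Proof. by move=> x y z; apply: zadicP => n /=; rewrite modzDml modzDmr addrA. Qed.

Lemma zadic_addC : commutative zadic_add.
Proof. by move=> x y; apply: zadicP => n /=; rewrite addrC. Qed.

Lemma zadic_add0 : left_id (of_int 0) zadic_add.
Proof. by move=> x; apply: zadicP => n /=; rewrite mod0z add0r residue_mod. Qed.

Lemma zadic_addN : left_inverse (of_int 0) zadic_opp zadic_add.
Proof. by move=> x; apply: zadicP => n /=; rewrite modzDml addNr. Qed.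

HB.instance Definition _ := gen_eqMixin zadic.
HB.instance Definition _ := gen_choiceMixin zadic.
HB.instance Definition _ := GRing.isZmodule.Build zadic
  zadic_addA zadic_addC zadic_add0 zadic_addN.

Lemma residueD (x y : zadic) n : (x + y) n = ((x n + y n) %% pow5 n)%Z.
Proof. by []. Qed.

Lemma residueN (x : zadic) n : (- x) n = ((- x n) %% pow5 n)%Z.
Proof. by []. Qed.

Lemma residueB (x y : zadic) n : (x - y) n = ((x n - y n) %% pow5 n)%Z.
Proof. by rewrite residueD residueN modzDmr. Qed.

Lemma residue0 n : (0 : zadic) n = 0. Proof. exact: mod0z. Qed.

Lemma residue_int t n : of_int t n = (t %% pow5 n)%Z. Proof. by []. Qed.

Lemma residue_at0 (x : zadic) : x 0%N = 0.
Proof. by rewrite -residue_mod modz1. Qed.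

Lemma of_intD s t : of_int (s + t) = of_int s + of_int t.
Proof. by apply: zadicP => n; rewrite residueD !residue_int modzDm. Qed.

Lemma of_int0 : of_int 0 = 0. Proof. by []. Qed.

Lemma of_intN s : of_int (- s) = - of_int s.
Proof. by apply: zadicP => n; rewrite residueN !residue_int modzNm. Qed.

Lemma of_int_eq0 t : of_int t = 0 -> t = 0.
Proof.
move=> t0; have : of_int t `|t|%N = 0 by rewrite t0 residue0.
rewrite residue_int => /dvdz_mod0P; rewrite dvdzE abszX.
case: (posnP `|t|%N) => [/eqP|tgt0 /(dvdn_leq tgt0)]; first by rewrite absz_eq0 => /eqP.
by rewrite leqNgt ltn_expl.
Qed.

Lemma of_intB s t : of_int (s - t) = of_int s - of_int t.
Proof. by rewrite of_intD of_intN. Qed.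

Lemma of_int_inj : injective of_int.
Proof.
move=> s t /eqP; rewrite -subr_eq0 -of_intB => /eqP/of_int_eq0/eqP.
by rewrite subr_eq0 => /eqP.
Qed.

Lemma residue_ge0 (x : zadic) n : 0 <= x n.
Proof. by rewrite -residue_mod modz_ge0// pow5_neq0. Qed.

Lemma residue_lt (x : zadic) n : x n < pow5 n.
Proof. by rewrite -residue_mod ltz_pmod// pow5_gt0. Qed.

Lemma eq_residue_le (x y : zadic) m n : (m <= n)%N -> x n = y n -> x m = y m.
Proof. by move=> mn xy; rewrite !(residueP _ mn) xy. Qed.

Lemma eq_residueDr (x y z : zadic) n : (x + z) n = (y + z) n <-> x n = y n.
Proof.
split=> [|xy]; last by rewrite !residueD xy.
rewrite !residueD => /eqP; rewrite eqz_modDr => /eqP.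
by rewrite !residue_mod.
Qed.

Lemma of_int_dense (x : zadic) n : of_int (x n) n = x n.
Proof. by rewrite residue_int residue_mod. Qed.

(** * Leading digits and colorings *)

(** [x] has valuation [n] and first non-zero digit [d]. *)
Definition leads (x : zadic) (n : nat) (d : int) :=
  0 < d < 5 /\ x n.+1 = d * pow5 n.

Lemma leads_vanish x n d m : leads x n d -> (m <= n)%N -> x m = 0.
Proof.
move=> [_ xd] mn; rewrite (residueP _ (leqW mn)) xd; apply/dvdz_mod0P.
by rewrite dvdz_mull// dvdz_pow5.
Qed.

Lemma leads_neq0 x n d : leads x n d -> x n.+1 != 0.
Proof. by move=> [dd ->]; rewrite mulf_neq0// ?pow5_neq0//; lia. Qed.

Lemma leads_uniq x m n c d : leads x m c -> leads x n d -> m = n /\ c = d.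
Proof.
have le p q a b : leads x p a -> leads x q b -> (p <= q)%N.
  move=> xp xq; rewrite leqNgt; apply/negP => qp.
  by have /negP := leads_neq0 xq; rewrite (leads_vanish xp qp).
move=> xm xn; have mn : m = n.
  by apply/eqP; rewrite eqn_leq (le _ _ _ _ xm xn) (le _ _ _ _ xn xm).
subst n; split=> //; case: xm xn => _ xm [_ xn]; apply: (mulIf (pow5_neq0 m)).
by rewrite -xn -xm.
Qed.

Lemma leads_ex x : x != 0 -> exists n d, leads x n d.
Proof.
move=> x0; have ex : exists n, x n != 0.
  apply: contrapT => /forallNP all0; case/eqP: x0; apply: zadicP => n.
  by rewrite residue0; apply/eqP/negPn/negP/all0.
case: (ex_minnP ex) => -[|n]; first by rewrite residue_at0 eqxx.
move=> xn nmin; have xn0 : x n = 0.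
  by apply/eqP/negPn/negP => /nmin; rewrite ltnn.
have : (pow5 n %| x n.+1)%Z by apply/dvdz_mod0P; rewrite -residueP.
move=> /dvdzP[d xd]; exists n, d; split=> //.
have := residue_ge0 x n.+1; have := residue_lt x n.+1.
rewrite xd pow5S ltr_pM2r ?pow5_gt0// => d5; rewrite pmulr_lge0 ?pow5_gt0// => d0.
rewrite d5 lt_neqAle d0 !andbT eq_sym.
by apply: contraNneq xn => d00; rewrite xd d00 mul0r.
Qed.

Lemma leads_near x n d (y : zadic) : leads x n d -> y n.+1 = x n.+1 -> leads y n d.
Proof. by move=> [dd xd] yx; split; rewrite ?yx. Qed.

Lemma leadsN x n d : leads x n d -> leads (- x) n (5 - d).
Proof.
move=> [dd xd]; split; first by lia.
rewrite residueN xd -(modzMDl 1) mul1r modz_small pow5S -?mulrBl//.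
by rewrite mulr_ge0 ?ltW ?pow5_gt0//= ?ltr_pM2r ?pow5_gt0//; lia.
Qed.

(** The coloring of the non-zero 5-adic integers by whether the leading digit is
in [S].  It is locally constant on its domain, so that 0 is the only obstacle to a
continuous coloring. *)
Definition color (S : pred int) (x : zadic) : bool :=
  `[< exists n d, S d /\ leads x n d >].

Lemma colorE S x n d : leads x n d -> color S x = S d.
Proof.
move=> xd; apply/asboolP/idP => [[m [c [Sc xc]]]|Sd]; last by exists n, d.
by have [_ <-] := leads_uniq xc xd.
Qed.

Definition colors_all (S : pred int) := forall c, exists2 d, 0 < d < 5 & S d = c.

(** Since negation turns a leading digit [d] into [5 - d], this says that the
coloring changes under negation, see [color_opp]. *)
Definition color_odd (S : pred int) :=
  forall d, 0 < d < 5 -> S (5 - d) = ~~ S d.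

Lemma color_near S (x : zadic) : x != 0 ->
  exists n, forall y : zadic, y n = x n -> y != 0 /\ color S y = color S x.
Proof.
move=> /leads_ex[n [d xd]]; exists n.+1 => y yx.
have yd := leads_near xd yx; split; last by rewrite !(colorE _ xd) (colorE _ yd).
by apply: contraNneq (leads_neq0 yd) => ->; rewrite residue0.
Qed.

(** Integers converge to any given 5-adic integer through differences of any
given color: this is what puts both limits at a discontinuity into the
enveloping semigroup. *)
Lemma color_hit S c (k : zadic) n : colors_all S ->
  exists t, [/\ of_int t n = k n, of_int t - k != 0 & color S (of_int t - k) = c].
Proof.
move=> /(_ c)[d dd <-]; exists (k n.+1 + d * pow5 n).
have ld : leads (of_int (k n.+1 + d * pow5 n) - k) n d.
  split=> //; rewrite residueB residue_int modzDml addrAC subrr add0r modz_small//.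
  by rewrite pow5S; have := pow5_gt0 n; nia.
have ldn := leads_neq0 ld; split; last exact: colorE ld.
  by rewrite residue_int addrC modzMDl -residueP.
by apply: contraNneq ldn => ->; rewrite residue0.
Qed.

Lemma color_opp S x : color_odd S ->
  x != 0 -> color S (- x) = ~~ color S x.
Proof.
move=> SN /leads_ex[n [d xd]].
by rewrite (colorE S (leadsN xd)) (colorE S xd) SN//; case: xd.
Qed.

(** The sums of distinct powers of 5 form a Cantor set, distinct points of which
differ by a number with leading digit 1 or -1 = 4. *)
Definition digit_sum (u : nat -> bool) (n : nat) : int :=
  \sum_(k < n) (u k)%:Z * pow5 k.

Lemma digit_sumS u n : digit_sum u n.+1 = digit_sum u n + (u n)%:Z * pow5 n.
Proof. exact: big_ord_recr. Qed.

Lemma digit_sum_compatible u m n : (m <= n)%N ->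
  (digit_sum u m %% pow5 m)%Z = (digit_sum u n %% pow5 m)%Z.
Proof.
elim: n => [|n IH]; first by rewrite leqn0 => /eqP->.
rewrite leq_eqVlt => /predU1P[->//|]; rewrite ltnS => mn.
rewrite IH// digit_sumS addrC; have /dvdzP[q ->] := dvdz_pow5 mn.
by rewrite mulrA modzMDl.
Qed.

Definition cantor_point u : zadic := of_compatible (@digit_sum_compatible u).

Lemma cantor_point_diff u v : u <> v ->
  exists n, leads (cantor_point u - cantor_point v) n 1 \/
            leads (cantor_point u - cantor_point v) n 4.
Proof.
move=> uv; have ex : exists n, u n != v n.
  by apply: contrapT => /forallNP h; apply/uv/funext => n; apply/eqP/negPn/negP/h.
case: (ex_minnP ex) => n unv nmin; exists n.
have same : digit_sum u n = digit_sum v n.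
  apply: eq_bigr => k _; suff -> : u k = v k by [].
  by apply/eqP/negPn/negP => /nmin; rewrite leqNgt ltn_ord.
have : (cantor_point u - cantor_point v) n.+1 =
    (((u n)%:Z - (v n)%:Z) * pow5 n %% pow5 n.+1)%Z.
  rewrite residueB /= modzDml -modzDmr modzNm modzDmr !digit_sumS same.
  by congr modz; rewrite opprD addrACA subrr add0r mulrBl.
case: (u n) (v n) unv => [] [] // _ E; [left|right]; split=> //; rewrite E.
  by rewrite subr0 modz_small// pow5S; have := pow5_gt0 n; lia.
rewrite -(modzMDl 1) modz_small ?pow5S; have := pow5_gt0 n; lia.
Qed.

Lemma cantor_point_inj : injective cantor_point.
Proof.
move=> u v uv; apply: contrapT => /cantor_point_diff[n].
by rewrite uv subrr => -[] /leads_neq0; rewrite residue0.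
Qed.

(** * The odometer and the colored systems *)

Definition residue_ord (n : nat) (x : zadic) : 'I_(5 ^ n).-1.+1 := inord `|x n|%N.

Lemma residue_ord_inj n x y : residue_ord n x = residue_ord n y -> x n = y n.
Proof.
have lt5 (z : zadic) : (`|z n| < (5 ^ n).-1.+1)%N.
  rewrite prednK ?expn_gt0// -ltz_nat gez0_abs ?residue_ge0//.
  by rewrite -[X in _ < X]natz natrX; exact: residue_lt.
move=> /(congr1 val); rewrite /= !inordK ?lt5// => /(congr1 Posz).
by rewrite !gez0_abs ?residue_ge0.
Qed.

Definition zadic_levels : levels.
Proof.
refine (@Levels zadic 0 (fun n x y => x n = y n) _ _ _ _ _) => //.
- by move=> n x y z ->.
- by move=> m n x y; exact: eq_residue_le.
- exact: zadicP.
Defined.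

Notation odometer R := (lspace R zadic_levels).

Lemma odometer_compact (R : realType) : compact [set: odometer R].
Proof.
apply: lspace_compact => [n|u un].
  by exists 'I_(5 ^ n).-1.+1, (residue_ord n) => x y /residue_ord_inj.
have uP m n : (m <= n)%N -> (u m m %% pow5 m)%Z = (u n n %% pow5 m)%Z.
  move=> mn; rewrite residue_mod -residueP//.
  elim: n mn => [|n IH]; first by rewrite leqn0 => /eqP->.
  rewrite leq_eqVlt => /predU1P[->//|]; rewrite ltnS => mn.
  by rewrite IH//; apply: eq_residue_le mn _; exact: un.
by exists (of_compatible uP) => n /=; rewrite residue_mod.
Qed.

Section ColoredPoints.
Variable S : pred int.

(** A point is a 5-adic integer [base] with the sequence of colors seen along
its integer orbit; the orbit passes through 0 at most once, and the color seen
there is free.  Over the base this is one point, except over an integer, where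
there are two. *)
Record cpoint := CPoint {
  base : zadic;
  bit : int -> bool;
  bitP : forall n, base + of_int n != 0 -> bit n = color S (base + of_int n) }.

Lemma cpoint_eq x y : base x = base y -> bit x =1 bit y -> x = y.
Proof.
case: x y => [a u au] [b v bv] /= ab /funext uv.
by subst; congr CPoint; exact: Prop_irrelevance.
Qed.

Definition fill (z : zadic) (c : bool) (n : int) : bool :=
  if z + of_int n == 0 then c else color S (z + of_int n).

Lemma fill_subproof z c n : z + of_int n != 0 ->
  fill z c n = color S (z + of_int n).
Proof. by rewrite /fill => /negbTE ->. Qed.

Definition point_over z c := CPoint (@fill_subproof z c).

(** When the orbit of [base x] avoids 0 both choices of [c] give the same point,
so every point can be treated as if it had a color at the discontinuity. *)
Lemma point_over_base x : exists c, x = point_over (base x) c.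
Proof.
have [[n xn]|nx] := pselect (exists n, base x + of_int n = 0).
  exists (bit x n); apply: cpoint_eq => //= m; rewrite /fill.
  case: eqP => [xm|/eqP]; last exact: bitP.
  congr bit; apply: of_int_inj; apply: (addrI (base x)); by rewrite xm xn.
exists false; apply: cpoint_eq => //= m; rewrite /fill.
by case: eqP => [xm|/eqP]; [case: nx; exists m|exact: bitP].
Qed.

Lemma zshift_subproof t x n : base x + of_int t + of_int n != 0 ->
  bit x (n + t) = color S (base x + of_int t + of_int n).
Proof. by rewrite -addrA -of_intD [t + n]addrC; exact: bitP. Qed.

Definition zshift t x := CPoint (@zshift_subproof t x).

Lemma zshift0 x : zshift 0 x = x.
Proof. by apply: cpoint_eq => /= [|n]; rewrite ?of_int0 addr0. Qed.

Lemma zshiftD s t x : zshift (s + t) x = zshift s (zshift t x).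
Proof.
apply: cpoint_eq => /= [|n]; last by rewrite addrA.
by rewrite of_intD addrAC addrA.
Qed.

(** When both colors occur, this is the limit, in the enveloping semigroup, of
integers that tend to [k] through differences of color [c]: on the base it is
the translation by [k], and it fills the discontinuity with [c] whatever was
there before. *)
Definition translate (k : zadic) (c : bool) (x : cpoint) := point_over (base x + k) c.

Lemma zshift_over t z c : zshift t (point_over z c) = point_over (z + of_int t) c.
Proof.
by apply: cpoint_eq => //= n; rewrite /fill -addrA -of_intD [t + n]addrC.
Qed.

Definition cpoint_levels : levels.
Proof.
refine (@Levels cpoint (point_over 0 false) (fun n x y => base x n = base y n /\
  forall k : int, (`|k| <= n)%N -> bit x k = bit y k) _ _ _ _ _) => //.
- by move=> n x y [xy b]; split=> // k /b.
- by move=> n x y z [-> xy] [-> yz]; split=> // k kn; rewrite xy// yz.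
- move=> m n x y mn [xy b]; split; first exact: eq_residue_le xy.
  by move=> k km; apply: b; exact: leq_trans mn.
- move=> x y xy; apply: cpoint_eq => [|k].
    by apply: zadicP => n; case: (xy n).
  by have [_] := xy `|k|%N; apply.
Defined.

(** The defining condition passes to limits because the coloring is locally
constant where the condition says something. *)
Lemma cpoint_lev_complete (u : nat -> cpoint_levels) :
  (forall n, lev n (u n) (u n.+1)) -> exists x, forall n, lev n (u n) x.
Proof.
move=> un; have umn m n : (m <= n)%N -> lev m (u m) (u n).
  elim: n => [|n IH]; first by rewrite leqn0 => /eqP->; exact: lev_refl.
  rewrite leq_eqVlt => /predU1P[->|]; first exact: lev_refl.
  rewrite ltnS => mn; apply: lev_trans (IH mn) _; apply: lev_le mn _; exact: un.
have uP m n : (m <= n)%N ->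
    (base (u m) m %% pow5 m)%Z = (base (u n) n %% pow5 m)%Z.
  by move=> mn; rewrite residue_mod -residueP//; have [] := umn _ _ mn.
have uB k : of_compatible uP + of_int k != 0 ->
    bit (u `|k|%N) k = color S (of_compatible uP + of_int k).
  move=> /(color_near S)[m mP].
  have [|ne <-] := mP (base (u (maxn m `|k|%N)) + of_int k).
    apply: (eq_residueDr _ _ _ _).2; rewrite /= residue_mod.
    by have [->] := umn m _ (leq_maxl m `|k|%N).
  have [_ ->//] := umn `|k|%N _ (leq_maxr m `|k|%N).
  by rewrite bitP.
exists (CPoint uB) => n; split=> /= [|k kn].
  by rewrite residue_mod.
by have [_ ->] := umn _ _ kn.
Qed.

Lemma cpoint_compact (R : realType) : compact [set: lspace R cpoint_levels].
Proof.
apply: lspace_compact => [n|]; last exact: cpoint_lev_complete.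
exists ('I_(5 ^ n).-1.+1 * {ffun 'I_n.*2.+1 -> bool})%type.
exists (fun x : cpoint =>
  (residue_ord n (base x), [ffun i : 'I_n.*2.+1 => bit x ((i : nat)%:Z - n%:Z)])).
move=> x y [/residue_ord_inj xy /ffunP b]; split=> //.
move=> k kn; have := b (inord (absz (k + n%:Z))).
rewrite !ffunE inordK; last by lia.
by have -> : (absz (k + n%:Z))%:Z - n%:Z = k by lia.
Qed.

End ColoredPoints.

(** * The enveloping semigroup of a colored system *)

Section Ellis.
Variables (R : realType) (S : pred int).
Notation X := (lspace R (cpoint_levels S)).
Implicit Types (p q : X -> X) (x : X).

(** The image of a reference point over 0; for the maps in [ellis] below it is
the translation induced on the base. *)
Definition angle p : zadic := base (p (point_over S 0 false)).

(** Two closed conditions satisfied by the shifts, hence by the whole enveloping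
semigroup.  They suffice to control its topology, so that its elements never
need to be classified. *)
Definition ellis p :=
  (forall x, base (p x) = base x + angle p) /\
  (forall t x, p (zshift t x) = zshift t (p x)).

(** Nearness to [p]: the angles agree up to level [n], and the values at the
discontinuity agree exactly.  The points over [- angle p] are those that [p]
sends over 0. *)
Definition window n p : set (X -> X) := [set q | angle q n = angle p n /\
  forall c, bit (q (point_over S (- angle p) c)) 0 =
            bit (p (point_over S (- angle p) c)) 0].

Lemma window_le m n p : (m <= n)%N -> window n p `<=` window m p.
Proof. by move=> mn q [rq bq]; split=> //; exact: eq_residue_le rq. Qed.

(** If [p x] does not pass through 0 at time [k], the color there depends only on
a finite level of the angle.  If it does, commuting with the shift reduces the
question to the points over [- angle p] at time 0, which a window records. *)
Lemma window_bit p x k : ellis p ->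
  exists n, forall q, ellis q -> window n p q -> bit (p x) k = bit (q x) k.
Proof.
move=> [pb ps]; have [xk|] := eqVneq (base x + angle p + of_int k) 0.
  exists 0%N => q [qb qs] [_ bq]; have [c xc] := point_over_base (zshift k x).
  have bk r : ellis r -> bit (r x) k = bit (r (zshift k x)) 0.
    by move=> [_ rs]; rewrite rs /= add0r.
  have bx : base (zshift k x) = - angle p.
    by apply/eqP; rewrite -addr_eq0 /= addrAC xk.
  by rewrite !bk// xc bx bq.
move=> /[dup] xk /(color_near S)[n nP]; exists n => q [qb qs] [rq _].
have [|qk ck] := nP (base x + angle q + of_int k).
  apply: (eq_residueDr _ _ _ _).2; rewrite ![base x + _]addrC.
  exact: (eq_residueDr _ _ _ _).2.
by rewrite !bitP ?pb ?qb.
Qed.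

Lemma window_lev p x n : ellis p ->
  exists m, forall q, ellis q -> window m p q ->
    @lev (cpoint_levels S) n (p x) (q x).
Proof.
move=> ep; elim: n => [|n [m mP]].
  have [m mP] := window_bit x 0 ep; exists m => q eq wq; split=> [|k].
    by rewrite !residue_at0.
  by rewrite leqn0 absz_eq0 => /eqP->; exact: mP.
have [m1 m1P] := window_bit x n.+1 ep.
have [m2 m2P] := window_bit x (- n.+1%:Z) ep.
exists (maxn n.+1 (maxn m (maxn m1 m2))) => q eq wq; split.
  have [[pb _] [qb _]] := (ep, eq); rewrite pb qb ![base x + _]addrC.
  apply: (eq_residueDr _ _ _ _).2; have [rq _] := window_le (leq_maxl _ _) wq.
  by rewrite rq.
move=> k kn.
have kcase : (`|k| <= n)%N \/ k = n.+1%:Z \/ k = - n.+1%:Z by lia.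
have le1 : (m <= maxn n.+1 (maxn m (maxn m1 m2)))%N by lia.
have le2 : (m1 <= maxn n.+1 (maxn m (maxn m1 m2)))%N by lia.
have le3 : (m2 <= maxn n.+1 (maxn m (maxn m1 m2)))%N by lia.
case: kcase => [kn'|[->|->]].
- by have [_ ->] := mP q eq (window_le le1 wq).
- exact: m1P eq (window_le le2 wq).
- exact: m2P eq (window_le le3 wq).
Qed.

Lemma nbhs_eval p x n :
  nbhs (p : {ptws X -> X}) [set q | @lev (cpoint_levels S) n (p x) (q x)].
Proof.
have /= : nbhs (p x) [set y : X | @lev (cpoint_levels S) n (p x) y].
  by apply/nbhs_lev; exists n.
exact: (@proj_continuous X (fun=> X) x p).
Qed.

Lemma nbhs_eval2 p x y m n : nbhs (p : {ptws X -> X})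
  [set q | @lev (cpoint_levels S) m (p x) (q x) /\
           @lev (cpoint_levels S) n (p y) (q y)].
Proof.
have FF : Filter (nbhs (p : {ptws X -> X})) by exact: nbhs_filter.
exact: filterI (nbhs_eval p x m) (nbhs_eval p y n).
Qed.

Lemma window_nbhs p n : nbhs (p : {ptws X -> X}) (window n p).
Proof.
pose y c := point_over S (- angle p) c.
have FF : Filter (nbhs (p : {ptws X -> X})) by exact: nbhs_filter.
apply: filterS (filterI (nbhs_eval p (point_over S 0 false) n)
  (nbhs_eval2 p (y false) (y true) 0 0)).
move=> q [[rq _] [[_ q0] [_ q1]]]; split; first by rewrite /angle rq.
by case; [rewrite -q1|rewrite -q0].
Qed.

(** Together with [window_nbhs]: on the enveloping semigroup, the windows at [p]
form a countable neighborhood basis of [p].  The filter they generate converges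
to [p] pointwise by [window_lev]. *)
Lemma window_base p (U : set {ptws X -> X}) : ellis p ->
  nbhs (p : {ptws X -> X}) U -> exists n, forall q, ellis q -> window n p q -> U q.
Proof.
move=> ep; pose F : set_system (X -> X) :=
  filter_from [set: nat] (fun n => [set q | ellis q /\ window n p q]).
have FF : Filter F.
  apply: filter_from_filter; first by exists 0%N.
  move=> m n _ _; exists (maxn m n) => // q [eq wq]; split; split=> //.
    exact: window_le (leq_maxl _ _) _ wq.
  exact: window_le (leq_maxr _ _) _ wq.
have Fp : {ptws, F --> p}.
  apply/pointwise_cvgP => x V /nbhs_lev[n nV].
  have [m mP] := window_lev x n ep; exists m => // q [eq wq].
  by apply: nV; exact: mP.
by move=> /Fp[n _ nU]; exists n => q eq wq; exact: nU.
Qed.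

Lemma zshift_ellis t : ellis (zshift t).
Proof.
split=> [x|s x]; first by rewrite /angle /= add0r.
by rewrite -!zshiftD addrC.
Qed.

Lemma angle_zshift t : angle (zshift t) = of_int t. Proof. exact: add0r. Qed.

Lemma angle_translate k c : angle (translate k c) = k. Proof. exact: add0r. Qed.

Lemma translate_ellis k c : ellis (translate k c).
Proof.
split=> [x|t x]; first by rewrite angle_translate.
by rewrite /translate zshift_over /= addrAC.
Qed.

Lemma zshift_lev t n (x y : X) :
  @lev (cpoint_levels S) (n + `|t|) x y ->
  @lev (cpoint_levels S) n (zshift t x) (zshift t y).
Proof.
move=> [xy b]; split=> [|k kn]; last by apply: b; lia.
apply: (eq_residueDr (base x) (base y) (of_int t) n).2.
by apply: eq_residue_le xy; exact: leq_addr.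
Qed.

Lemma zshift_continuous t : continuous (zshift t : X -> X).
Proof.
move=> x U /nbhs_lev[n nU]; apply/nbhs_lev; exists (n + `|t|)%N => y xy.
by apply: nU; exact: zshift_lev.
Qed.

Definition zshifts : set {ptws X -> X} := range (@zshift S).

(** Each condition of [ellis] involves two values of [q], which a shift can
approximate simultaneously. *)
Lemma closure_zshifts_ellis q : closure zshifts q -> ellis q.
Proof.
move=> cq; split=> [x|t x].
  apply: zadicP => n.
  have [_ [[t _ <-] [[xt _] [x0t _]]]] := cq _
    (nbhs_eval2 q x (point_over S 0 false) n n).
  rewrite xt -[base (zshift t x)]/(base x + of_int t) ![base x + _]addrC.
  apply: (eq_residueDr _ _ _ _).2; rewrite /angle x0t.
  by rewrite -[base (zshift t _)]/(0 + of_int t) add0r.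
apply: lev_sep => n.
have [_ [[s _ <-] [l1 l2]]] := cq _
  (nbhs_eval2 q (zshift t x) x n (n + `|t|)).
apply: (lev_trans l1); apply: lev_sym; rewrite -zshiftD addrC zshiftD.
exact: zshift_lev.
Qed.

Lemma zshift_in_window k c n : colors_all S ->
  exists t, window n (translate k c) (zshift t).
Proof.
move=> all; have [t [tk t0 tc]] := color_hit c k n all; exists t.
split=> [|b]; first by rewrite angle_zshift angle_translate.
rewrite angle_translate /= /fill /= !add0r !of_int0 !addr0 addNr eqxx addrC (negbTE t0).
by rewrite tc.
Qed.

Lemma translate_closure k c : colors_all S -> closure zshifts (translate k c).
Proof.
move=> all U /(window_base (translate_ellis k c))[n nU].
have [t wt] := zshift_in_window k c n all.
by exists (zshift t); split; [exists t|apply: nU => //; exact: zshift_ellis].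
Qed.

Lemma zshifts_first_countable : first_countable (set_type (closure zshifts)).
Proof.
apply: (@first_countable_subspace {ptws X -> X} (closure zshifts) window)
  => [p _ n|p U Ep nU].
  exact: window_nbhs.
have [n nP] := window_base (closure_zshifts_ellis Ep) nU.
by exists n => q /closure_zshifts_ellis; exact: nP.
Qed.

(** Any point [y] is the image of [x] under a suitable [translate], which is a
pointwise limit of shifts. *)
Lemma zshift_orbit_dense (x y : X) (U : set X) : colors_all S -> nbhs y U ->
  exists t, U (zshift t x).
Proof.
move=> all Uy; have [c yc] := point_over_base y.
have yx : translate (base y - base x) c x = y by rewrite /translate addrC subrK.
have : nbhs (translate (base y - base x) c : {ptws X -> X}) [set q | U (q x)].
  have Ux : nbhs (translate (base y - base x) c x : X) U by rewrite yx.
  exact: (@proj_continuous X (fun=> X) x (translate (base y - base x) c) U Ux).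
by move=> /(@translate_closure _ c all)[_ [[t _ <-] Ut]]; exists t.
Qed.

End Ellis.

(** * Hereditary separability of the enveloping semigroup *)

Section EllisSeparability.
Variables (R : realType) (S : pred int).
Notation X := (lspace R (cpoint_levels S)).
Implicit Types (p q : X -> X) (x : X).

(** What a map of [ellis] does at the discontinuity.  With the angle it
determines the map. *)
Definition germ p : bool * bool :=
  (bit (p (point_over S (- angle p) false)) 0, bit (p (point_over S (- angle p) true)) 0).

Lemma bit_translate k c z b :
  bit (translate k c (point_over S z b)) 0 =
  if z + k == 0 then c else color S (z + k).
Proof. by rewrite /= /fill of_int0 addr0. Qed.

(** A map of angle different from [z] sends the points over [- z] to points over
[angle q - z], away from the discontinuity. *)
Lemma bit_ellis q z c : ellis q -> angle q != z ->
  bit (q (point_over S (- z) c)) 0 = color S (angle q - z).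
Proof.
move=> [qb _] qz; have E : base (q (point_over S (- z) c)) + of_int 0 = angle q - z.
  by rewrite qb of_int0 addr0 addrC.
by rewrite bitP E// subr_eq0.
Qed.

Lemma ellis_germ_inj p q : ellis p -> ellis q -> angle p = angle q ->
  germ p = germ q -> p = q.
Proof.
move=> ep eq pq [g0 g1]; apply/funext => x; apply: lev_sep => n.
have [m mP] := window_lev x n ep; apply: mP => //; split; first by rewrite pq.
by case; [rewrite g1|rewrite g0]; rewrite pq.
Qed.

(** Two different values require two different points over [- angle p]. *)
Lemma germ_neq p : (germ p).1 != (germ p).2 -> exists t, angle p = of_int t.
Proof.
move=> gp; apply: contrapT => /forallNP np.
suff E : point_over S (- angle p) false = point_over S (- angle p) true.
  by rewrite /= E eqxx in gp.
apply: cpoint_eq => //= n; rewrite /fill; case: eqP => // /eqP.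
by rewrite addrC subr_eq0 => /eqP/esym /np.
Qed.

(** So near [p] the topology is one-sided, as on the Sorgenfrey line: the angles
that come close to [angle p] lie on the side given by the color of the
difference. *)
Lemma window_color p q n : ellis q -> angle q n = angle p n -> angle q != angle p ->
  germ p = (color S (angle q - angle p), color S (angle q - angle p)) -> window n p q.
Proof.
move=> eq qp nqp [g0 g1]; split=> // c; rewrite bit_ellis//.
by case: c; [rewrite g1|rewrite g0].
Qed.

(** The analogue of a point of [A] isolated from the right in the Sorgenfrey
line. *)
Definition isolated_angle (A : set (X -> X)) p :=
  A p /\ exists n, forall q, A q -> window n p q -> angle q = angle p.

(** Take two isolated elements of [A] with different angles, with windows of the
same level, agreeing at this level, and with the same germ [(c, c)].  The two
differences of their angles have opposite colors, so one of them has color [c]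
and one element lies in the window of the other, a contradiction.  The other
germs occur only at integer angles.  Hence level, residue, germ and, where the
angle is an integer, this integer determine an isolated element. *)
Lemma countable_isolated_angle A : color_odd S -> A `<=` @ellis R S ->
  countable (isolated_angle A).
Proof.
move=> odd Ae.
have /choice[N NP] p : exists n, isolated_angle A p ->
    forall q, A q -> window n p q -> angle q = angle p.
  by have [[Ap [n nP]]|np] := pselect (isolated_angle A p); [exists n|exists 0%N].
have /choice[T TP] p : exists t, (exists s, angle p = of_int s) -> angle p = of_int t.
  have [[s sp]|np] := pselect (exists s, angle p = of_int s); [by exists s|by exists 0].
apply/countable_injP.
exists (fun p => pickle ((N p, angle p (N p)), (germ p, T p))).
move=> p q /set_mem ip /set_mem iq /(pcan_inj pickleK).
move: (NP p ip) (NP q iq) => Np Nq [nn rr gg0 gg1 Tpq].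
have [Ap Aq] := (ip.1, iq.1).
have [pq|pq] := eqVneq (angle p) (angle q).
  apply: ellis_germ_inj => //; [exact: Ae|exact: Ae|].
  by rewrite /germ; congr pair.
exfalso; have germE : germ p = germ q by rewrite /germ; congr pair.
have geq : (germ p).1 = (germ p).2.
  apply/eqP/negPn/negP => gp; case/eqP: pq.
  have Tp := TP p (germ_neq gp).
  have Tq : angle q = of_int (T q) by apply/TP/germ_neq; rewrite -germE.
  by rewrite Tp Tq Tpq.
have germP c : (germ p).1 = c -> germ p = (c, c).
  by move=> <-; rewrite {1}(surjective_pairing (germ p)) -geq.
have qp : angle q != angle p by rewrite eq_sym.
have qp0 : angle q - angle p != 0 by rewrite subr_eq0.
have opp := color_opp odd qp0; rewrite opprB in opp.
have [cE|cE] := eqVneq (germ p).1 (color S (angle q - angle p)).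
  apply: (negP qp); apply/eqP/Np => //.
  by apply: window_color; [exact: Ae|rewrite rr nn|exact: qp|exact: germP].
apply: (negP pq); apply/eqP/Nq => //.
apply: window_color; [exact: Ae|by rewrite -nn rr nn|exact: pq|].
rewrite -germE; apply: germP; rewrite opp.
by case: (germ p).1 (color S (angle q - angle p)) cE => [] [].
Qed.

(** The isolated elements of [A], which are countably many, together with one
element of [A] over each residue class are dense in [A]: a window at a
non-isolated [p] contains a [q] in [A] with another angle, hence also every
element of [A] whose angle is close to that of [q]. *)
Lemma zshifts_hereditarily_separable : color_odd S ->
  hereditarily_separable (set_type (closure (@zshifts R S))).
Proof.
move=> odd.
apply: (@hereditarily_separable_subspace {ptws X -> X} (closure (@zshifts R S))
  (@window R S)).
- move=> p V cp pV; have [n nP] := window_base (closure_zshifts_ellis cp) pV.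
  by exists n => q /closure_zshifts_ellis; exact: nP.
move=> A AE; have Ae : A `<=` @ellis R S by move=> q /AE/closure_zshifts_ellis.
pose hit (z : int * nat) p := A p /\ angle p z.2 = z.1.
have /choice[g gP] z : exists q, (exists p, hit z p) -> hit z q.
  by have [[p zp]|nz] := pselect (exists p, hit z p); [exists p|exists id].
exists (isolated_angle A `|` [set g z | z in [set z | exists p, hit z p]]); split.
- rewrite -bigcup2E; apply: bigcup_countable => [|[|[|i]] _ /=].
  + exact: countableP.
  + exact: countable_isolated_angle.
  + by apply: sub_countable (card_image_le _ _) _; exact: countableP.
  + exact: countable0.
- by move=> p [[]//|[z /gP[Ag _] <-]].
move=> p Ap n; have [ip|np] := pselect (isolated_angle A p).
  by exists p; [left|split].
have [q [Aq wq qp]] : exists q, [/\ A q, window n p q & angle q != angle p].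
  apply: contrapT => /forallNP nq; apply: np; split=> //; exists n => q Aq wq.
  by apply: contrapT => /eqP qp; apply: (nq q).
have qp0 : angle q - angle p != 0 by rewrite subr_eq0.
have [m mP] := color_near S qp0.
pose z := (angle q (maxn n m), maxn n m).
have zq : hit z q by [].
have [Ag gq] := gP z (ex_intro _ q zq).
exists (g z); first by right; exists z => //; exists q.
have [|gp0 gc] := mP (angle (g z) - angle p).
  apply: (eq_residueDr _ _ _ _).2; exact: eq_residue_le (leq_maxr n m) gq.
apply: window_color; first exact: Ae.
- have [<- _] := wq; exact: eq_residue_le (leq_maxl n m) gq.
- by rewrite -subr_eq0.
rewrite gc /germ; have [_ <-] := wq; have [_ <-] := wq.
by rewrite !bit_ellis//; exact: Ae.
Qed.

(** If the differences of the points of the Cantor set have color [false], the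
elements [translate a true], with [a] in the Cantor set, are isolated from each
other: membership in a window at one of them requires the color [true]. *)
Lemma zshifts_not_hereditarily_separable :
  colors_all S -> S 1 = false -> S 4 = false ->
  ~ hereditarily_separable (set_type (closure (@zshifts R S))).
Proof.
move=> all S1 S4.
apply: (@not_hereditarily_separable {ptws X -> X} _
  (fun u => translate (cantor_point u) true)) => [u|u].
  exact: translate_closure.
set p : X -> X := translate _ _.
exists [set q | lev 0 (p (point_over S (- cantor_point u) false))
                      (q (point_over S (- cantor_point u) false))].
  exact: nbhs_eval.
move=> v [_ /(_ 0 isT)]; rewrite /p !bit_translate addNr eqxx.
case: eqP => [|_].
  by rewrite addrC => /subr0_eq/cantor_point_inj.
rewrite addrC => vu; apply: contrapT => /cantor_point_diff[n [] /(colorE S) E];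
by rewrite E ?S1 ?S4 in vu.
Qed.
End EllisSeparability.

(** * The dynamical systems *)

Lemma discrete_continuous (T U : topologicalType) (f : T -> U) :
  (forall t : T, nbhs t [set t]) -> continuous f.
Proof.
move=> disc t V Vt; apply: filterS (disc t) => _ ->.
exact: nbhs_singleton Vt.
Qed.

(** The acting group acts through a homomorphism to the integers, so that the
same systems serve for the integers and for each factor of the group of pairs of
integers. *)
Section Actions.
Variables (R : realType) (T : topologicalGroupType) (phi : T -> int).
Hypothesis discT : forall t : T, nbhs t [set t].
Hypothesis phi1 : phi 1%g = 0.
Hypothesis phiM : forall s t, phi (s * t)%g = phi s + phi t.
Hypothesis phi_surj : forall n, exists t, phi t = n.

Section ColoredSystem.
Variable S : pred int.
Notation X := (lspace R (cpoint_levels S)).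

Definition colored_action (t : T) : X -> X := zshift (phi t).

Lemma colored_system : dynamical_system colored_action.
Proof.
split.
- by split; [exact: cpoint_compact|exact: lspace_hausdorff].
- split; first by apply/funext => x; rewrite /colored_action phi1 zshift0.
  by move=> s t; apply/funext => x; rewrite /colored_action phiM zshiftD.
- by move=> t; exact: zshift_continuous.
- exact: discrete_continuous.
Qed.

Lemma colored_enveloping :
  enveloping_semigroup colored_action = closure (@zshifts R S).
Proof.
congr closure; apply/seteqP; split=> [_ [t _ <-]|_ [n _ <-]].
  by exists (phi t).
by have [t <-] := phi_surj n; exists t.
Qed.

Lemma colored_minimal : colors_all S -> minimal_system colored_action.
Proof.
move=> all; split; first exact: colored_system.
  by exists (point_over S 0 false).
move=> A cA [x Ax] sA; apply/seteqP; split=> // y _; apply: cA => U Uy.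
have [n Un] := zshift_orbit_dense x all Uy; have [t tn] := phi_surj n.
exists (zshift n x); split=> //; apply: (sA t); exists x => //.
by rewrite /colored_action tn.
Qed.

Lemma colored_tame1 : tame1 R colored_action.
Proof.
split; [exact: colored_system|exact: lspace_metrizable|].
by rewrite colored_enveloping; exact: zshifts_first_countable.
Qed.

Lemma colored_tame2 : color_odd S -> tame2 R colored_action.
Proof.
move=> odd; split; [exact: colored_system|exact: lspace_metrizable|].
by rewrite colored_enveloping; exact: zshifts_hereditarily_separable.
Qed.

End ColoredSystem.

Definition odometer_action (t : T) (z : odometer R) : odometer R :=
  (z : zadic) + of_int (phi t).

Lemma odometer_actionE t (z w : odometer R) n :
  @lev zadic_levels n z w ->
  @lev zadic_levels n (odometer_action t z) (odometer_action t w).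
Proof. by move=> zw; exact: (eq_residueDr _ _ _ _).2. Qed.

Lemma odometer_system : dynamical_system odometer_action.
Proof.
split.
- by split; [exact: odometer_compact|exact: lspace_hausdorff].
- split; first by apply/funext => x; rewrite /odometer_action phi1 of_int0 addr0.
  move=> s t; apply/funext => x.
  by rewrite /odometer_action /= phiM [phi s + _]addrC of_intD addrA.
- move=> t z U /nbhs_lev[n nU]; apply/nbhs_lev; exists n => w zw.
  by apply: nU; exact: odometer_actionE.
- exact: discrete_continuous.
Qed.

Lemma odometer_equicontinuous : equicontinuous [set: T] odometer_action.
Proof.
move=> z E /entourage_lev[n nE]; apply/nbhs_lev; exists n => w zw t _.
by apply: nE; exact: odometer_actionE.
Qed.

Lemma odometer_minimal : minimal_system odometer_action.
Proof.
split; [exact: odometer_system|by exists 0|].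
move=> A cA [x Ax] sA; apply/seteqP; split=> // y _; apply: cA => U /nbhs_lev[n nU].
have [t tn] := phi_surj (((y : zadic) - (x : zadic)) n).
exists (odometer_action t x); split; first by apply: (sA t); exists x.
apply: nU; rewrite /= /odometer_action tn.
rewrite addrC; have := (eq_residueDr ((y : zadic) - (x : zadic)) (of_int _) x n).2
  (esym (of_int_dense _ _)).
by rewrite subrK.
Qed.

Variable S : pred int.
Notation X := (lspace R (cpoint_levels S)).
Notation proj := (@base S : X -> odometer R).

(** The fiber is a singleton when the orbit avoids the discontinuity. *)
Lemma proj_fiber (x : X) :
  proj @^-1` [set proj x] = [set x] <-> forall n, base x + of_int n != 0.
Proof.
split=> [fx n|nx].
  apply/eqP => xn.
  have fxc c : point_over S (base x) c = x.
    by have : (proj @^-1` [set proj x]) (point_over S (base x) c) by []; rewrite fx.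
  have := congr1 (fun y => bit y n) (etrans (fxc true) (esym (fxc false))).
  by rewrite /= /fill xn eqxx.
apply/seteqP; split=> [y /= yx|_ -> //].
by apply: cpoint_eq => // n; rewrite !bitP ?yx.
Qed.

Lemma colored_factor : factor_map (colored_action (S := S)) odometer_action proj.
Proof.
split=> //.
  move=> x U /nbhs_lev[n nU]; apply/nbhs_lev; exists n => y [xy _].
  exact: nU.
by apply/seteqP; split=> // z _; exists (point_over S z false).
Qed.

(** The Cantor set is uncountable. *)
Lemma non_integer : exists z : zadic, forall n, z + of_int n != 0.
Proof.
apply: contrapT => /forallNP nz.
have /choice[f fP] u : exists n, cantor_point u + of_int n = 0.
  apply: contrapT => /forallNP nu; apply: (nz (cantor_point u)) => n; exact/eqP/nu.
apply: (@no_injection_to_nat (pickle \o f)) => u v /(pcan_inj pickleK) fuv.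
by apply/cantor_point_inj/(addIr (of_int (f u))); rewrite fP fuv fP.
Qed.

(** The points with singleton fiber are the countable intersection, over the
times [n], of the open sets of points not over [- n].  One such point exists,
and so does its whole orbit, which is dense. *)
Lemma colored_almost_one_to_one : colors_all S ->
  almost_one_to_one_extension R (colored_action (S := S)) odometer_action proj.
Proof.
move=> all; split.
- by split; [exact: colored_minimal|exact: odometer_minimal].
- by split; exact: lspace_metrizable.
- exact: colored_factor.
split.
  move=> U [y Uy] oU; have [z zn] := non_integer.
  have [|t Ut] := @zshift_orbit_dense R S (point_over S z false) y U all.
    exact: open_nbhs_nbhs.
  exists (zshift t (point_over S z false)); split=> //.
  by apply/proj_fiber => n /=; rewrite -addrA -of_intD.
exists (fun i => if unpickle i is Some n then [set x : X | base x + of_int n != 0]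
                 else setT).
  move=> i; case: (unpickle i) => [n|]; last exact: openT.
  rewrite openE => x /= xn; apply/nbhs_lev.
  have [m mP] := color_near S xn; exists m => y [xy _].
  have [] // := mP (base y + of_int n).
  by apply: (eq_residueDr _ _ _ _).2.
apply/seteqP; split=> x /=.
  by move=> /proj_fiber xn i _; case: (unpickle i).
by move=> xn; apply/proj_fiber => n; have := xn (pickle n) I; rewrite pickleK.
Qed.

Lemma colored_almost_automorphic : colors_all S ->
  almost_automorphic R (colored_action (S := S)).
Proof.
move=> all; split; first exact: colored_minimal.
exists (odometer R), odometer_action, proj.
by split; [exact: colored_almost_one_to_one|exact: odometer_equicontinuous].
Qed.

End Actions.

(** * The product of two colored systems *)

Lemma prod_hausdorff (U V : topologicalType) :
  hausdorff_space U -> hausdorff_space V -> hausdorff_space (U * V)%type.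
Proof.
have nbhs_fst (p : U * V) (A : set U) : nbhs p.1 A -> nbhs p (fst @^-1` A).
  by move=> pA; exists (A, setT) => /=; [split=> //; exact: filterT|by move=> w []].
have nbhs_snd (p : U * V) (A : set V) : nbhs p.2 A -> nbhs p (snd @^-1` A).
  by move=> pA; exists (setT, A) => /=; [split=> //; exact: filterT|by move=> w []].
move=> hU hV p q cl; rewrite [p]surjective_pairing [q]surjective_pairing.
congr pair; [apply: hU|apply: hV] => A B nA nB.
  have [w [Aw Bw]] := cl _ _ (nbhs_fst p A nA) (nbhs_fst q B nB).
  by exists w.1.
have [w [Aw Bw]] := cl _ _ (nbhs_snd p A nA) (nbhs_snd q B nB).
by exists w.2.
Qed.

Definition prod_levels (L M : levels) : levels.
Proof.
refine (@Levels (L * M)%type (basepoint L, basepoint M)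
  (fun n x y => lev n x.1 y.1 /\ lev n x.2 y.2) _ _ _ _ _).
- by move=> n x; split; exact: lev_refl.
- by move=> n x y [? ?]; split; exact: lev_sym.
- move=> n y x z [a1 a2] [b1 b2].
  by split; [exact: lev_trans a1 b1|exact: lev_trans a2 b2].
- by move=> m n x y mn [? ?]; split; exact: lev_le mn _.
- move=> [x1 x2] [y1 y2] xy; congr pair; apply: lev_sep => n; by case: (xy n).
Defined.

Lemma nbhs_prod_lev (R : realType) (L M : levels)
    (z : lspace R L * lspace R M) (U : set (lspace R L * lspace R M)) :
  nbhs z U <-> exists n, forall w, @lev (prod_levels L M) n z w -> U w.
Proof.
split=> [[[A B] [/= /nbhs_lev[m mA] /nbhs_lev[n nB]] ABU]|[n nU]].
  exists (maxn m n) => w [w1 w2]; apply: ABU; split=> /=.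
    by apply: mA; exact: lev_le (leq_maxl _ _) w1.
  by apply: nB; exact: lev_le (leq_maxr _ _) w2.
exists ([set x | lev n z.1 x], [set y | lev n z.2 y]) => /=.
  by split; apply/nbhs_lev; exists n.
by move=> w [/= w1 w2]; apply: nU.
Qed.

Lemma prod_lspace_metrizable (R : realType) (L M : levels) :
  metrizable R (lspace R L * lspace R M)%type.
Proof.
exists (lspace R (prod_levels L M)), id, id; split=> // z U.
  by move=> /nbhs_lev Un; apply/nbhs_prod_lev.
by move=> /nbhs_prod_lev Un; apply/nbhs_lev.
Qed.

(** The two coordinates are moved independently, so minimality of the product is
immediate and its enveloping semigroup is the product of the two semigroups. *)
Section Product.
Variables (R : realType) (T : topologicalGroupType) (phi psi : T -> int).
Hypothesis discT : forall t : T, nbhs t [set t].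
Hypothesis phi1 : phi 1%g = 0.
Hypothesis phiM : forall s t, phi (s * t)%g = phi s + phi t.
Hypothesis psi1 : psi 1%g = 0.
Hypothesis psiM : forall s t, psi (s * t)%g = psi s + psi t.
Hypothesis joint_surj : forall m n, exists t, phi t = m /\ psi t = n.

Variable S : pred int.
Notation X := (lspace R (cpoint_levels S)).
Notation XX := (X * X)%type.
Notation XL := (prod_levels (cpoint_levels S) (cpoint_levels S)).
Notation j := (@colored_action R T phi S).
Notation k := (@colored_action R T psi S).

Let phi_surj n : exists t, phi t = n.
Proof. by have [t []] := joint_surj n 0; exists t. Qed.

Let psi_surj n : exists t, psi t = n.
Proof. by have [t []] := joint_surj 0 n; exists t. Qed.

Lemma product_system : dynamical_system (product_action j k).
Proof.
have [_ [j1 jM] _ _] := colored_system R discT phi1 phiM S.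
have [_ [k1 kM] _ _] := colored_system R discT psi1 psiM S.
split.
- split; last by apply: prod_hausdorff; exact: lspace_hausdorff.
  by rewrite -setXTT; apply: compact_setX; exact: cpoint_compact.
- split; first by apply/funext => -[x y]; rewrite /product_action j1 k1.
  by move=> s t; apply/funext => -[x y]; rewrite /product_action jM kM.
- move=> t z U /nbhs_prod_lev[n nU]; apply/nbhs_prod_lev.
  exists (n + (`|phi t| + `|psi t|))%N => w [w1 w2]; apply: nU; split.
    by apply: zshift_lev; apply: lev_le w1; lia.
  by apply: zshift_lev; apply: lev_le w2; lia.
- exact: discrete_continuous.
Qed.

Lemma product_minimal : colors_all S -> minimal_system (product_action j k).
Proof.
move=> all; split; first exact: product_system.
  by exists (point_over S 0 false, point_over S 0 false).
move=> A cA [[x y] Axy] sA; apply/seteqP; split=> // -[x' y'] _; apply: cA => U.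
move=> [[V W] [/= Vx Wy] VWU].
have [m Vm] := zshift_orbit_dense x all Vx.
have [n Wn] := zshift_orbit_dense y all Wy.
have [t [tm tn]] := joint_surj m n.
exists (product_action j k t (x, y)); split; first by apply: (sA t); exists (x, y).
by apply: VWU; rewrite /product_action /colored_action /= tm tn.
Qed.

Lemma colored_disjoint : colors_all S -> disjoint_systems j k.
Proof.
move=> all.
by split; [exact: colored_minimal|exact: colored_minimal|exact: product_minimal].
Qed.

Notation E := (enveloping_semigroup (product_action j k)).
Let o : X := point_over S 0 false.

(** The coordinates of a map that acts on each factor separately; [o] is an
arbitrary reference point. *)
Definition first_part (q : XX -> XX) (x : X) : X := (q (x, o)).1.
Definition second_part (q : XX -> XX) (y : X) : X := (q (o, y)).2.
Definition pair_map (p q : X -> X) (z : XX) : XX := (p z.1, q z.2).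

Lemma nbhs_prod_eval (q : XX -> XX) z n :
  nbhs (q : {ptws XX -> XX})
    [set r | @lev XL n (q z) (r z)].
Proof.
have qz : nbhs (q z)
    [set w : XX | @lev XL n (q z) w].
  by apply/nbhs_prod_lev; exists n.
exact: (@proj_continuous XX (fun=> XX) z q _ qz).
Qed.

Lemma first_part_continuous :
  continuous (first_part : {ptws XX -> XX} -> {ptws X -> X}).
Proof.
move=> q; have FF : Filter (nbhs (q : {ptws XX -> XX})) by exact: nbhs_filter.
apply/pointwise_cvgP => x U /nbhs_lev[n nU].
by apply: filterS (nbhs_prod_eval q (x, o) n) => r [l _]; exact: nU.
Qed.

Lemma second_part_continuous :
  continuous (second_part : {ptws XX -> XX} -> {ptws X -> X}).
Proof.
move=> q; have FF : Filter (nbhs (q : {ptws XX -> XX})) by exact: nbhs_filter.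
apply/pointwise_cvgP => x U /nbhs_lev[n nU].
by apply: filterS (nbhs_prod_eval q (o, x) n) => r [_ l]; exact: nU.
Qed.

Lemma closure_product_ellis q : E q ->
  [/\ ellis (first_part q), ellis (second_part q) &
      q = pair_map (first_part q) (second_part q)].
Proof.
move=> Eq; split.
- apply: closure_zshifts_ellis => U /first_part_continuous/Eq[_ [[t _ <-] Ut]].
  by exists (zshift (phi t)); split; [exists (phi t)|].
- apply: closure_zshifts_ellis => U /second_part_continuous/Eq[_ [[t _ <-] Ut]].
  by exists (zshift (psi t)); split; [exists (psi t)|].
apply/funext => -[x y]; apply: (@lev_sep XL) => n.
have FF : Filter (nbhs (q : {ptws XX -> XX})) by exact: nbhs_filter.
have [_ [[t _ <-] [[a b] [[c _] [_ d]]]]] := Eq _ (filterI (nbhs_prod_eval q (x, y) n)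
  (filterI (nbhs_prod_eval q (x, o) n) (nbhs_prod_eval q (o, y) n))).
split.
  exact: lev_trans a (lev_sym c).
exact: lev_trans b (lev_sym d).
Qed.

Definition product_window n (q : XX -> XX) : set (XX -> XX) :=
  [set r | window n (first_part q) (first_part r) /\
           window n (second_part q) (second_part r)].

Lemma product_window_nbhs n q :
  nbhs (q : {ptws XX -> XX}) (product_window n q).
Proof.
have FF : Filter (nbhs (q : {ptws XX -> XX})) by exact: nbhs_filter.
apply: filterI.
  exact: first_part_continuous (window_nbhs (first_part q) n).
exact: second_part_continuous (window_nbhs (second_part q) n).
Qed.

Lemma pair_map_base (p q : X -> X) (U : set {ptws XX -> XX}) :
  ellis p -> ellis q -> nbhs (pair_map p q : {ptws XX -> XX}) U ->
  exists n, forall p' q', ellis p' -> ellis q' -> window n p p' -> window n q q' ->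
    U (pair_map p' q').
Proof.
move=> ep eq.
pose F : set_system (XX -> XX) := filter_from [set: nat] (fun n =>
  [set r | exists p' q', [/\ r = pair_map p' q', ellis p' /\ ellis q',
     window n p p' & window n q q']]).
have FF : Filter F.
  apply: filter_from_filter; first by exists 0%N.
  move=> m n _ _; exists (maxn m n) => // r [p' [q' [-> e wp wq]]].
  split; exists p', q'; split=> //.
  - exact: window_le (leq_maxl _ _) _ wp.
  - exact: window_le (leq_maxl _ _) _ wq.
  - exact: window_le (leq_maxr _ _) _ wp.
  - exact: window_le (leq_maxr _ _) _ wq.
have Fp : {ptws, F --> pair_map p q}.
  apply/pointwise_cvgP => -[x y] V /nbhs_prod_lev[n nV].
  have [m1 m1P] := window_lev x n ep.
  have [m2 m2P] := window_lev y n eq.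
  exists (maxn m1 m2) => // _ [p' [q' [-> [ep' eq'] wp wq]]].
  apply: nV; split.
    by apply: m1P => //; exact: window_le (leq_maxl _ _) _ wp.
  by apply: m2P => //; exact: window_le (leq_maxr _ _) _ wq.
move=> /Fp[n _ nU]; exists n => p' q' ep' eq' wp wq.
by apply: nU; exists p', q'.
Qed.

Lemma product_tame1 : tame1 R (product_action j k).
Proof.
split; [exact: product_system|exact: prod_lspace_metrizable|].
apply: (@first_countable_subspace {ptws XX -> XX} E product_window).
  by move=> q _ n; exact: product_window_nbhs.
move=> q U /closure_product_ellis[e1 e2 qE] nU.
have [|n nP] := pair_map_base e1 e2 (U := U); first by rewrite -qE.
exists n => r /closure_product_ellis[e1' e2' rE] [w1 w2].
by rewrite rE; exact: nP.
Qed.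

Lemma translate_product_closure a b c d : colors_all S ->
  E (pair_map (translate a c) (translate b d)).
Proof.
move=> all U /(pair_map_base (@translate_ellis R S a c) (@translate_ellis R S b d))[n nU].
have [s ws] := @zshift_in_window R S a c n all.
have [t wt] := @zshift_in_window R S b d n all.
have [g [gs gt]] := joint_surj s t.
exists (pair_map (zshift s) (zshift t)); split; last first.
  by apply: nU => //; exact: zshift_ellis.
exists g => //; apply/funext => -[x y].
by rewrite /product_action /colored_action /pair_map gs gt.
Qed.

(** The antidiagonal of the Sorgenfrey plane: at [u] the pair has angles [a] and
[- a].  Its windows require the differences [b - a] and [a - b] to have the same
color, which is impossible for an odd coloring unless [b = a]. *)
Lemma product_not_tame2 : colors_all S -> color_odd S ->
  ~ tame2 R (product_action j k).
Proof.
move=> all odd [_ _]; pose P u := pair_map (translate (cantor_point u) true)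
  (translate (- cantor_point u) true).
apply: (@not_hereditarily_separable {ptws XX -> XX} E P) => u.
  exact: translate_product_closure.
pose z := (point_over S (- cantor_point u) false,
           point_over S (- - cantor_point u) false).
exists [set q | @lev XL 0 (P u z) (q z)].
  exact: nbhs_prod_eval.
move=> v [[_ /(_ 0 isT) b1] [_ /(_ 0 isT) b2]].
move: b1 b2; rewrite /P /pair_map !bit_translate !addNr !eqxx.
have [uv _ _|vu] := eqVneq (- cantor_point u + cantor_point v) 0.
  by move: uv; rewrite addrC => /subr0_eq/cantor_point_inj.
have E2 : - - cantor_point u - cantor_point v = - (- cantor_point u + cantor_point v).
  by rewrite opprD.
by rewrite E2 oppr_eq0 (negbTE vu) (color_opp odd vu) => <-.
Qed.

End Product.

(** * The two examples *)

(** The pairs of integers as a discrete group. *)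
Definition Z2group : Type := Algebra.to_multiplicative (int * int)%type.

HB.instance Definition _ := Group.on Z2group.
HB.instance Definition _ := hasNbhs.Build Z2group principal_filter.
HB.instance Definition _ := Discrete_ofNbhs.Build Z2group erefl.

Lemma Z2group_discrete (t : Z2group) : nbhs t [set t].
Proof. exact/principal_filterP. Qed.

Lemma Z2group_mulg_continuous :
  continuous (fun p : Z2group * Z2group => (p.1 * p.2)%g).
Proof.
move=> [x y] A /= /principal_filterP Axy.
exists ([set x], [set y]) => /=; first by split; exact: Z2group_discrete.
by move=> [a b] /= [-> ->].
Qed.

HB.instance Definition _ := isTopologicalGroup.Build Z2group
  Z2group_mulg_continuous (discrete_continuous Z2group_discrete).

Theorem proposition4p1 (R : realType) :
  (exists (X : topologicalType) (j : Zgroup -> X -> X),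
     [/\ almost_automorphic R j, tame1 R j & ~ tame2 R j])
  /\
  (exists (T : topologicalGroupType) (X Y : topologicalType)
      (j : T -> X -> X) (k : T -> Y -> Y),
     [/\ minimal_system j /\ minimal_system k,
         tame2 R j /\ tame2 R k,
         disjoint_systems j k,
         minimal_system (product_action j k) /\ tame1 R (product_action j k) &
         ~ tame2 R (product_action j k)]).
Proof.
split.
  (* A set of digits that is symmetric under negation and avoids 1 and 4, the
     leading digits of differences in the Cantor set. *)
  pose S : pred int := fun d => (d == 2) || (d == 3).
  have all : colors_all S by case; [exists 2|exists 1].
  pose phi (t : Zgroup) : int := t.
  have disc (t : Zgroup) : nbhs t [set t] by exact/principal_filterP.
  have surj n : exists t, phi t = n by exists n.
  exists (lspace R (cpoint_levels S)), (@colored_action R _ phi S); split.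
  - exact: colored_almost_automorphic.
  - exact: colored_tame1.
  - case=> _ _; rewrite colored_enveloping//.
    exact: zshifts_not_hereditarily_separable.
(* One digit out of each pair of opposite digits. *)
pose S : pred int := fun d => (d == 1) || (d == 2).
have all : colors_all S by case; [exists 1|exists 3].
have odd : color_odd S by rewrite /color_odd /S => d; lia.
pose phi (t : Z2group) : int := t.1.
pose psi (t : Z2group) : int := t.2.
have joint m n : exists t, phi t = m /\ psi t = n by exists (m, n).
have surj1 n : exists t, phi t = n by exists (n, 0).
have surj2 n : exists t, psi t = n by exists (0, n).
exists Z2group, (lspace R (cpoint_levels S)), (lspace R (cpoint_levels S)).
exists (@colored_action R _ phi S), (@colored_action R _ psi S).
have disc := Z2group_discrete.
split.
- by split; exact: colored_minimal.
- by split; exact: colored_tame2.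
- exact: colored_disjoint.
- by split; [exact: product_minimal|exact: product_tame1].
- exact: product_not_tame2.
Qed.
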